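(* Let $\kappa$ be a measurable kernel on $\mathbb R^d$ and $P,Q$ probability measures on $\mathbb R^d$. Then $u^{\mathrm{MMD}}$ defines a kernel on $\mathbb R^{2d}$. Moreover, let $\nu>2$, let $\mathbf Z_1,\mathbf Z_2$ be i.i.d. with law $P\otimes Q$, and suppose that $\mathbb E[u^{\mathrm{MMD}}(\mathbf Z_1,\mathbf Z_1)]<\infty$ and that, for a weak Mercer representation $\{\lambda_k\}_{k\ge1},\{\phi_k\}_{k\ge1}$ of $u^{\mathrm{MMD}}$ under $P\otimes Q$ and for some $\nu^*>\nu$, $$\|u^{\mathrm{MMD}}(\mathbf Z_1,\mathbf Z_2)\|_{L_{\nu^*}}<\infty\quad\text{and}\quad\sup_{K\ge1}\Big\|\sum_{k=1}^K\lambda_k\phi_k(\mathbf Z_1)\phi_k(\mathbf Z_2)\Big\|_{L_{\nu^*}}<\infty.$$ Then, with $\nu'=\min\{\nu,3\}$, there exist real sequences $\{\lambda_k\}_{k\ge1}$ and functions $\{\phi_k\}_{k\ge1}$ on $\mathbb R^{2d}$ such that $$\Big\|\sum_{k=1}^K\lambda_k\phi_k(\mathbf Z_1)\phi_k(\mathbf Z_2)-u^{\mathrm{MMD}}(\mathbf Z_1,\mathbf Z_2)\Big\|_{L_{\nu'}}\to0\quad\text{as }K\to\infty.$$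
   Context: A function $\kappa:\mathbb R^d\times\mathbb R^d\to\mathbb R$ is a kernel on $\mathbb R^d$ if there are a Hilbert space $(\mathcal H,\langle\cdot,\cdot\rangle_{\mathcal H})$ and a map $\phi:\mathbb R^d\to\mathcal H$ with $\kappa(\mathbf x,\mathbf x')=\langle\phi(\mathbf x),\phi(\mathbf x')\rangle_{\mathcal H}$ for all $\mathbf x,\mathbf x'\in\mathbb R^d$. For $(\mathbf x,\mathbf y),(\mathbf x',\mathbf y')\in\mathbb R^{2d}$, $u^{\mathrm{MMD}}((\mathbf x,\mathbf y),(\mathbf x',\mathbf y'))=\kappa(\mathbf x,\mathbf x')+\kappa(\mathbf y,\mathbf y')-\kappa(\mathbf x,\mathbf y')-\kappa(\mathbf x',\mathbf y)$. $\|Y\|_{L_\nu}=\mathbb E[|Y|^\nu]^{1/\nu}$. For a measurable kernel $\kappa^*$ on $\mathbb R^b$, a probability measure $R$ on $\mathbb R^b$ and $\mathbf V_1,\mathbf V_2$ i.i.d. $\sim R$, a weak Mercer representation of $\kappa^*$ under $R$ is a sequence of functions $\{\phi_k\}_{k\ge1}$ in $L_2(\mathbb R^b,R)$ and a sequence of non-negative values $\{\lambda_k\}_{k\ge1}$ with $\lambda_k\to0$ such that $\big|\sum_{k=1}^K\lambda_k\phi_k(\mathbf V_1)\phi_k(\mathbf V_2)-\kappa^*(\mathbf V_1,\mathbf V_2)\big|\to0$ almost surely as $K\to\infty$. *)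

(* Defs.v *)
From HB Require Import structures.
From mathcomp Require Import all_boot all_order all_algebra.
From mathcomp Require Import all_classical all_reals all_analysis.
Import Order.TTheory GRing.Theory Num.Theory.
Import numFieldNormedType.Exports.

Set Implicit Arguments.
Unset Strict Implicit.
Unset Printing Implicit Defensive.

Local Open Scope classical_set_scope.
Local Open Scope ring_scope.

(* R^d: the sigma-algebra that the library puts on d.-tuple R is generated by
   the coordinate maps, hence is the Borel sigma-algebra. R^(2d) is rendered as
   the measurable product euclid R d * euclid R d. *)
Notation euclid R d := (d.-tuple (measurableTypeR R)).

(* A real Hilbert space is a complete normed module whose norm is the one
   induced by the inner product <u, v> := ip u v. *)
Definition is_hilbert (R : realType) (H : completeNormedModType R)
    (ip : {dot H for idfun}) : Prop :=
  forall u : H, `|u| = Num.sqrt (ip u u).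

Definition is_kernel (R : realType) (X : Type) (kappa : X -> X -> R) : Prop :=
  exists (H : completeNormedModType R) (ip : {dot H for idfun}) (phi : X -> H),
    is_hilbert ip /\ forall x x', kappa x x' = ip (phi x) (phi x').

Definition is_measurable_kernel (R : realType) (d : measure_display)
    (X : measurableType d) (kappa : X -> X -> R) : Prop :=
  is_kernel kappa /\
  measurable_fun [set: X * X] (fun z => kappa z.1 z.2).

Definition uMMD (R : realType) (X : Type) (kappa : X -> X -> R)
    (z z' : X * X) : R :=
  kappa z.1 z'.1 + kappa z.2 z'.2 - kappa z.1 z'.2 - kappa z'.1 z.2.

(* Laws are compared on measurable sets only: the values of a measure on
   nonmeasurable sets carry no information. *)
Definition has_law (R : realType) (dO dT : measure_display)
    (Omega : measurableType dO) (T : measurableType dT)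
    (Pr : probability Omega R) (mu : probability T R) (V : {RV Pr >-> T}) :
    Prop :=
  forall A : set T, measurable A -> distribution Pr V A = mu A.

Definition independent_RV (R : realType) (dO dT : measure_display)
    (Omega : measurableType dO) (T : measurableType dT)
    (Pr : probability Omega R) (V1 V2 : {RV Pr >-> T}) : Prop :=
  forall A B : set T, measurable A -> measurable B ->
    Pr (V1 @^-1` A `&` V2 @^-1` B) = (Pr (V1 @^-1` A) * Pr (V2 @^-1` B))%E.

Definition iid (R : realType) (dO dT : measure_display)
    (Omega : measurableType dO) (T : measurableType dT)
    (Pr : probability Omega R) (mu : probability T R) (V1 V2 : {RV Pr >-> T}) :
    Prop :=
  [/\ has_law mu V1, has_law mu V2 & independent_RV V1 V2].

(* Sequences are indexed from 0: the k-th term of a sequence indexed from 1 is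
   stored at index k - 1. *)
Definition mercer_sum (R : realType) (T : Type) (lambda : nat -> R)
    (phi : nat -> T -> R) (K : nat) (v v' : T) : R :=
  \sum_(0 <= k < K) lambda k * phi k v * phi k v'.

(* V1 and V2 are meant to be i.i.d. with law mu. *)
Definition weak_mercer (R : realType) (dO dT : measure_display)
    (Omega : measurableType dO) (T : measurableType dT)
    (Pr : probability Omega R) (mu : probability T R) (V1 V2 : {RV Pr >-> T})
    (kappa : T -> T -> R) (lambda : nat -> R) (phi : nat -> T -> R) : Prop :=
  [/\ forall k, phi k \in Lfun mu 2%:E,
      forall k, 0 <= lambda k,
      lambda @ \oo --> (0 : R) &
      {ae Pr, forall w,
        `|mercer_sum lambda phi K (V1 w) (V2 w) - kappa (V1 w) (V2 w)|
          @[K --> \oo] --> (0 : R)}].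

(* Main.v *)
Require Import Defs.
From HB Require Import structures.
From mathcomp Require Import all_boot all_order all_algebra.
From mathcomp Require Import all_classical all_reals all_analysis.
From mathcomp Require Import measurable_realfun ring.
Import Order.TTheory GRing.Theory Num.Theory.
Import numFieldNormedType.Exports.
Local Open Scope classical_set_scope.
Local Open Scope ring_scope.

(** If phi is a feature map of kappa into a Hilbert space H, then
    (x, y) |-> phi x - phi y is a feature map of u^MMD into the same H:
    expanding <phi x - phi y, phi x' - phi y'> by bilinearity and symmetry gives
    the four terms of u^MMD ([is_kernel_uMMD]).

    For the approximation, the given Mercer pair itself works. The error
    D_K = S_K - u, where S_K is the K-th Mercer sum and u the kernel, both taken
    at (Z1, Z2), tends to 0 almost surely, and by Minkowski's inequality it is
    bounded in L_(nu-star), an exponent strictly above min(nu, 3) <= nu. On a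
    finite measure space, almost sure convergence together with a bound in L_q
    forces convergence in every L_r with r < q ([cvg0_Lnorm_of_bounded]): the
    L_q bound makes the powers |D_K|^r uniformly integrable. Quantitatively,
    cutting |D| at a height M costs

      |D|^r <= min(|D|, M)^r + M^(r - q) |D|^q      ([powR_le_trunc]),

    where the integral of the last term is small for M large, uniformly in K,
    and the integral of the first one tends to 0 for fixed M by dominated
    convergence. *)

Lemma is_kernel_uMMD (R : realType) (X : Type) (kappa : X -> X -> R) :
  is_kernel kappa -> is_kernel (uMMD kappa).
Proof.
move=> [H [ip [phi [hip kE]]]].
exists H, ip, (fun z => phi z.1 - phi z.2); split => // z z'.
rewrite /uMMD !kE linearBl !linearBr /=.
rewrite (hermC ip (phi z'.1) (phi z.2)) expr0 mul1r /= !opprB !addrA.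
ring.
Qed.

Lemma cvge0_le_nearP (R : realType) (u : nat -> \bar R) :
  (forall n, 0 <= u n)%E ->
  u n @[n --> \oo] --> (0 : \bar R) <->
  (forall e : R, 0 < e -> \forall n \near \oo, (u n <= e%:E)%E).
Proof.
move=> u0; split => [/fine_cvgP[ufin /cvgr0_norm_le uc] e e0|ue].
  near=> n; have un : u n \is a fin_num by near: n.
  rewrite -(fineK un) lee_fin (le_trans (ler_norm _))//.
  by near: n; exact: uc.
apply/fine_cvgP; split.
  near=> n; rewrite ge0_fin_numE//.
  apply: (@le_lt_trans _ _ 1%:E); last exact: ltry.
  by near: n; exact: ue.
apply/cvgrPdist_le => e e0; near=> n.
have une : (u n <= e%:E)%E by near: n; exact: ue.
rewrite sub0r normrN /= ger0_norm ?fine_ge0// -lee_fin fineK//.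
by rewrite ge0_fin_numE// (le_lt_trans une)// ltry.
Unshelve. all: by end_near. Qed.

Lemma cvg_norm_powR (R : realType) (r : R) (u : nat -> R) : 0 < r ->
  u n @[n --> \oo] --> 0 -> `|u n| `^ r @[n --> \oo] --> 0.
Proof.
move=> r0 u0; apply/cvgrPdist_le => e e0; near=> n.
rewrite sub0r normrN ger0_norm ?powR_ge0//.
have -> : e = (e `^ r^-1) `^ r by rewrite -powRrM mulVf ?gt_eqF// powRr1// ltW.
rewrite ge0_ler_powR ?nnegrE ?powR_ge0//; first exact: ltW.
near: n; have /cvgr0_norm_le := u0; apply; exact: powR_gt0.
Unshelve. all: by end_near. Qed.

(** Above the height M, x ^ r = x ^ (r - q) * x ^ q and the negative exponent
    r - q turns x > M into x ^ (r - q) <= M ^ (r - q). *)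
Lemma powR_le_trunc (R : realType) (r q M x : R) : 0 < r -> r < q -> 0 < M ->
  0 <= x -> x `^ r <= Num.min x M `^ r + M `^ (r - q) * x `^ q.
Proof.
move=> r0 rq M0 x0; case: (leP x M) => xM.
  by rewrite lerDl mulr_ge0 ?powR_ge0.
have xp : 0 < x by exact: lt_trans xM.
apply: ler_wpDl; first exact: powR_ge0.
have -> : x `^ r = x `^ (r - q) * x `^ q.
  by rewrite -powRD ?subrK// (gt_eqF xp) implybT.
rewrite ler_wpM2r ?powR_ge0//.
rewrite -(opprB q r) !powRN lef_pV2 ?posrE ?powR_gt0//.
by rewrite ge0_ler_powR ?nnegrE// ?subr_ge0; exact: ltW.
Qed.

Lemma measurable_norm_powR d (T : measurableType d) (R : realType) (r : R)
    (f : T -> R) : measurable_fun setT f ->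
  measurable_fun setT (fun x => (`|f x| `^ r)%:E : \bar R).
Proof.
move=> mf; apply/measurable_EFinP.
apply: (measurableT_comp (measurable_powR r)).
exact: measurableT_comp.
Qed.

(** The case of Vitali's convergence theorem where uniform integrability comes
    from a bound on a higher moment. *)
Lemma cvg0_moment_of_bounded d (T : measurableType d) (R : realType)
    (mu : {finite_measure set T -> \bar R}) (r q B : R) (D : nat -> T -> R) :
  0 < r -> r < q -> (forall n, measurable_fun setT (D n)) ->
  {ae mu, forall x, D n x @[n --> \oo] --> 0} ->
  (\forall n \near \oo, (\int[mu]_x (`|D n x| `^ q)%:E <= B%:E)%E) ->
  (\int[mu]_x (`|D n x| `^ r)%:E)%E @[n --> \oo] --> (0 : \bar R).
Proof.
move=> r0 rq mD D0 DB.
have mom0 s n : (0 <= \int[mu]_x (`|D n x| `^ s)%:E)%E.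
  by apply: integral_ge0 => x _; rewrite lee_fin powR_ge0.
apply/cvge0_le_nearP => // e e0.
(* The height M is chosen so that M ^ (r - q) = c, which makes the tail term of
   the truncation at most c * B <= e / 2. *)
pose c := (e / 2) / (`|B| + 1).
have B1 : 0 < `|B| + 1 by rewrite ltr_wpDl.
have c0 : 0 < c by rewrite !divr_gt0.
pose M := c `^ (r - q)^-1.
have M0 : 0 < M by exact: powR_gt0.
have Mc : M `^ (r - q) = c.
  by rewrite -powRrM mulVf ?powRr1 ?ltW// subr_eq0 lt_eqF.
pose t n x := Num.min `|D n x| M `^ r.
have mt n : measurable_fun setT (fun x => (t n x)%:E : \bar R).
  apply/measurable_EFinP; apply: (measurableT_comp (measurable_powR r)).
  apply: measurable_minr => //; exact: measurableT_comp.
have min0 n x : 0 <= Num.min `|D n x| M by rewrite le_min normr_ge0 ltW.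
have t0 : (\int[mu]_x (t n x)%:E)%E @[n --> \oo] --> (0 : \bar R).
  have [] := @dominated_convergence _ _ _ mu setT measurableT
    (fun n x => (t n x)%:E) (cst 0%E) (cst (M `^ r)%:E) mt.
  - exact: measurable_cst.
  - apply: filterS D0 => x Dx _.
    apply/cvg_EFin; first by near=> n.
    apply: (@squeeze_cvgr _ _ _ _ (cst 0) (fun n => `|D n x| `^ r)).
    + near=> n; rewrite /= powR_ge0/= ge0_ler_powR ?nnegrE ?ge_min ?lexx//.
      exact: ltW.
    + exact: cvg_cst.
    + exact: cvg_norm_powR.
  - exact/finite_measure_integrable_cst.
  - apply: aeW => x n _ /=; rewrite lee_fin ger0_norm ?powR_ge0//.
    by rewrite ge0_ler_powR ?nnegrE ?ge_min ?lexx ?orbT//; exact: ltW.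
  - by rewrite integral_cst// mul0e.
have tpos n : (0 <= \int[mu]_x (t n x)%:E)%E.
  by apply: integral_ge0 => x _; rewrite lee_fin powR_ge0.
near=> n.
have -> : e%:E = ((e / 2)%:E + (e / 2)%:E)%E by rewrite -EFinD -splitr.
apply: (@le_trans _ _ (\int[mu]_x ((t n x)%:E + c%:E * (`|D n x| `^ q)%:E))%E).
  apply: ge0_le_integral => //.
  - exact: measurable_norm_powR.
  - apply: emeasurable_funD => //.
    by apply: measurable_funeM; exact: measurable_norm_powR.
  - by move=> x _; rewrite -EFinM -EFinD lee_fin -Mc powR_le_trunc.
rewrite ge0_integralD//; last 3 first.
- by move=> x _; rewrite lee_fin powR_ge0.
- by move=> x _; rewrite -EFinM lee_fin mulr_ge0 ?powR_ge0// ltW.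
- by apply: measurable_funeM; exact: measurable_norm_powR.
rewrite ge0_integralZl//; last 2 first.
- exact: measurable_norm_powR.
- by rewrite lee_fin ltW.
apply: leeD.
  by near: n; apply: (iffLR (cvge0_le_nearP _ _ tpos) t0); exact: divr_gt0.
apply: (@le_trans _ _ (c%:E * B%:E)%E).
  by rewrite lee_pmul2l// ?lte_fin//; near: n.
rewrite -EFinM lee_fin /c mulrAC ler_pdivrMr// ler_wpM2l// ?divr_ge0 ?ltW//.
by rewrite (le_lt_trans (ler_norm B))// ltrDl.
Unshelve. all: by end_near. Qed.

(** Norms, unlike moments, obey Minkowski's inequality, so a bound on an error
    f - g comes in this form. *)
Lemma cvg0_Lnorm_of_bounded d (T : measurableType d) (R : realType)
    (mu : {finite_measure set T -> \bar R}) (r q C : R) (D : nat -> T -> R) :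
  0 < r -> r < q -> (forall n, measurable_fun setT (D n)) ->
  {ae mu, forall x, D n x @[n --> \oo] --> 0} ->
  (\forall n \near \oo, ('N[mu]_(q%:E)[EFin \o D n] <= C%:E)%E) ->
  'N[mu]_(r%:E)[EFin \o D n]%E @[n --> \oo] --> (0 : \bar R).
Proof.
move=> r0 rq mD D0 DC.
have NE s n : 0 < s ->
    ('N[mu]_(s%:E)[EFin \o D n] `^ s = \int[mu]_x (`|D n x| `^ s)%:E)%E.
  by move=> s0; rewrite poweR_Lnorm ?gt_eqF.
have q0 : 0 < q by exact: lt_trans rq.
have momr : (\int[mu]_x (`|D n x| `^ r)%:E)%E @[n --> \oo] --> (0 : \bar R).
  apply: (@cvg0_moment_of_bounded _ _ _ _ _ q (C `^ q)) => //; near=> n.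
  have NC : ('N[mu]_(q%:E)[EFin \o D n] <= C%:E)%E by near: n.
  rewrite -NE// -poweR_EFin gt0_ler_poweR ?in_itv/= ?leey ?andbT ?Lnorm_ge0//.
    exact: ltW.
  by apply: le_trans NC; exact: Lnorm_ge0.
have mom0 n : (0 <= \int[mu]_x (`|D n x| `^ r)%:E)%E.
  by apply: integral_ge0 => x _; rewrite lee_fin powR_ge0.
apply/cvge0_le_nearP => [n|e e0]; first exact: Lnorm_ge0.
near=> n.
rewrite unlock.
have -> : e%:E = ((e `^ r)%:E `^ r^-1)%E.
  by rewrite poweR_EFin -powRrM mulfV ?gt_eqF// powRr1// ltW.
rewrite gt0_ler_poweR ?in_itv/= ?leey ?andbT ?lee_fin ?powR_ge0//.
  by rewrite invr_ge0 ltW.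
by near: n; apply: (iffLR (cvge0_le_nearP _ _ mom0) momr); exact: powR_gt0.
Unshelve. all: by end_near. Qed.

Lemma measurable_uMMD d (T : measurableType d) (R : realType)
    (kappa : T -> T -> R) :
  measurable_fun [set: T * T] (fun z => kappa z.1 z.2) ->
  measurable_fun [set: (T * T) * (T * T)] (fun z => uMMD kappa z.1 z.2).
Proof.
move=> mk.
have mkc (f g : (T * T) * (T * T) -> T) : measurable_fun setT f ->
    measurable_fun setT g -> measurable_fun setT (fun z => kappa (f z) (g z)).
  by move=> mf mg; exact: measurableT_comp mk (measurable_fun_pair mf mg).
have m11 : measurable_fun setT (fun z : (T * T) * (T * T) => z.1.1).
  exact: measurableT_comp measurable_fst measurable_fst.
have m12 : measurable_fun setT (fun z : (T * T) * (T * T) => z.1.2).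
  exact: measurableT_comp measurable_snd measurable_fst.
have m21 : measurable_fun setT (fun z : (T * T) * (T * T) => z.2.1).
  exact: measurableT_comp measurable_fst measurable_snd.
have m22 : measurable_fun setT (fun z : (T * T) * (T * T) => z.2.2).
  exact: measurableT_comp measurable_snd measurable_snd.
apply: measurable_funB; last exact: mkc.
apply: measurable_funB; last exact: mkc.
by apply: measurable_funD; exact: mkc.
Qed.

Lemma measurable_mercer_sum dO d (Omega : measurableType dO)
    (T : measurableType d) (R : realType) (lambda : nat -> R)
    (phi : nat -> T -> R) (K : nat) (X Y : Omega -> T) :
  (forall k, measurable_fun setT (phi k)) ->
  measurable_fun setT X -> measurable_fun setT Y ->
  measurable_fun setT (fun w => mercer_sum lambda phi K (X w) (Y w)).
Proof.
move=> mphi mX mY; apply: measurable_sum => k.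
apply: measurable_funM; last exact: measurableT_comp (mphi k) mY.
apply: measurable_funM; first exact: measurable_cst.
exact: measurableT_comp (mphi k) mX.
Qed.

Theorem lemma15 (R : realType) (d : nat) (kappa : euclid R d -> euclid R d -> R)
    (P Q : probability (euclid R d) R)
    (hkappa : is_measurable_kernel kappa) :
  is_kernel (uMMD kappa) /\
  forall (nu : R) (hnu : 2 < nu)
    (dO : measure_display) (Omega : measurableType dO) (Pr : probability Omega R)
    (Z1 Z2 : {RV Pr >-> (euclid R d * euclid R d)%type})
    (hZ : iid (P \x Q)%E Z1 Z2)
    (hdiag : ('E_Pr[(fun w => uMMD kappa (Z1 w) (Z1 w))] < +oo)%E)
    (lambda : nat -> R) (phi : nat -> euclid R d * euclid R d -> R)
    (hmercer : weak_mercer (P \x Q)%E Z1 Z2 (uMMD kappa) lambda phi)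
    (nustar : R) (hnustar : nu < nustar)
    (hu : ('N[Pr]_(nustar%:E)[(fun w => (uMMD kappa (Z1 w) (Z2 w))%:E)] < +oo)%E)
    (hsup : (ereal_sup
      [set 'N[Pr]_(nustar%:E)[(fun w => (mercer_sum lambda phi K (Z1 w) (Z2 w))%:E)]
         | K in [set K : nat | (1 <= K)%N]] < +oo)%E),
  exists (lambda' : nat -> R) (phi' : nat -> euclid R d * euclid R d -> R),
    (forall k, measurable_fun setT (phi' k)) /\
    'N[Pr]_((Num.min nu 3)%:E)[(fun w =>
        (mercer_sum lambda' phi' K (Z1 w) (Z2 w) - uMMD kappa (Z1 w) (Z2 w))%:E)]%E
      @[K --> \oo] --> (0 : \bar R).
Proof.
have [kernel_kappa mkappa] := hkappa.
split=> [|nu hnu dO Omega Pr Z1 Z2 _ _ lambda phi [phi2 _ _ cvg_mercer] nustar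
  hnustar hu hsup]; first exact: is_kernel_uMMD.
have mphi k : measurable_fun setT (phi k).
  by have /sub_Lfun_mfun := phi2 k; rewrite inE.
exists lambda, phi; split=> //.
pose S K w := mercer_sum lambda phi K (Z1 w) (Z2 w).
pose U w := uMMD kappa (Z1 w) (Z2 w).
have mS K : measurable_fun setT (S K).
  by apply: measurable_mercer_sum => //; exact: measurable_funPT.
have mU : measurable_fun setT U.
  have mZ := measurable_fun_pair (measurable_funPT Z1) (measurable_funPT Z2).
  exact: measurableT_comp (measurable_uMMD _ _ _ _ mkappa) mZ.
have nu1 : 1 <= nustar.
  by apply: ltW; apply: lt_trans hnustar; apply: lt_trans hnu; rewrite ltr1n.
set s := ereal_sup _ in hsup.
have sup_ge K : (0 < K)%N -> ('N[Pr]_(nustar%:E)[EFin \o S K] <= s)%E.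
  by move=> K0; apply: ereal_sup_ubound; exists K.
have bound_fin : (s + 'N[Pr]_(nustar%:E)[EFin \o U])%E \is a fin_num.
  rewrite ge0_fin_numE ?lte_add_pinfty// adde_ge0 ?Lnorm_ge0//.
  by apply: le_trans (sup_ge 1 _) => //; exact: Lnorm_ge0.
apply: (@cvg0_Lnorm_of_bounded _ _ _ _ _ nustar
  (fine (s + 'N[Pr]_(nustar%:E)[EFin \o U])%E) (fun K w => S K w - U w)).
- by rewrite lt_min (lt_trans _ hnu)//= ltr0n.
- by rewrite gt_min hnustar.
- by move=> K; exact: measurable_funB.
- by apply: filterS cvg_mercer => w; exact: norm_cvg0.
(* The supremum ranges over K >= 1, hence the bound holds from rank 1 on. *)
exists 1%N => // K /= K1; rewrite fineK//.
have mNU : measurable_fun setT (\- U) by exact: measurableT_comp.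
apply: (le_trans (@eminkowski _ _ _ Pr (S K) (\- U) nustar%:E _ _ _)) => //.
apply: leeD; first exact: sup_ge.
by rewrite -[leRHS]oppe_Lnorm.
Qed.
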